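(* Let $G=(V,E,\mu)$ be an infinite, connected, locally finite weighted graph and let $(p,q)\in\mathbb{R}^2$. Suppose that at least one of the following two assumptions holds: (1) there is a constant $p_0\ge1$ such that $\frac{\mu_{xy}}{\mu(x)}\ge\frac1{p_0}$ for all $x\sim y$ in $V$, and $p<1-q$, $q<0$; (2) either ($p<1-q$ and $0\le q<1$) or $(p,q)=(1,0)$. Then the inequality $$\Delta u+u^p|\nabla u|^q\le 0\quad\text{on } V$$ admits no nontrivial positive solution.
   Context: Graphs are simple: at most one edge joins two distinct vertices and there are no loops. $x\sim y$ means that $x,y\in V$ are joined by an edge. A weighted graph $G=(V,E,\mu)$ has an edge weight with $\mu_{xy}=\mu_{yx}>0$ if $x\sim y$ and $\mu_{xy}=0$ otherwise; the vertex measure is $\mu(x)=\sum_{y\sim x}\mu_{xy}$. For $u:V\to\mathbb{R}$, $$\Delta u(x)=\sum_{y\sim x}\frac{\mu_{xy}}{\mu(x)}(u(y)-u(x)),\qquad |\nabla u(x)|=\sqrt{\sum_{y\sim x}\frac{\mu_{xy}}{2\mu(x)}(u(y)-u(x))^2}.$$ A nontrivial positive solution of the inequality is a non-constant function $u:V\to(0,\infty)$ satisfying it at every vertex. Conventions: $|\nabla u(x)|^0=1$; if $q<0$, then $|\nabla u(x)|^q=+\infty$ when $|\nabla u(x)|=0$, so the inequality at $x$ requires $|\nabla u(x)|>0$. *)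

(* Defs.v *)
From HB Require Import structures.
From mathcomp Require Import all_boot all_order all_algebra.
From mathcomp Require Import all_classical all_reals all_analysis.

Set Implicit Arguments.
Unset Strict Implicit.
Unset Printing Implicit Defensive.

Import Order.TTheory GRing.Theory Num.Theory.

Local Open Scope classical_set_scope.
Local Open Scope ring_scope.

Record weighted_graph (R : realType) (V : choiceType) := WeightedGraph {
  adj : rel V;
  weight : V -> V -> R;
  adj_irr : forall x, ~~ adj x x;
  adj_sym : forall x y, adj x y = adj y x;
  weight_sym : forall x y, weight x y = weight y x;
  weight_gt0 : forall x y, adj x y -> 0 < weight x y;
  weight_eq0 : forall x y, ~~ adj x y -> weight x y = 0
}.

Section WeightedGraph.
Context {R : realType} {V : choiceType} (G : weighted_graph R V).

Definition nbrs (x : V) : set V := [set y | adj G x y].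

Definition locally_finite_graph : Prop := forall x, finite_set (nbrs x).

Definition connected_graph : Prop :=
  forall x y, exists2 s : seq V, path (adj G) x s & last x s = y.

(* The finitely supported sums below take the value 0 when the support is
   infinite: they are meaningful for locally finite graphs only. *)
Definition vmeasure (x : V) : R := \sum_(y \in nbrs x) weight G x y.

Definition laplacian (u : V -> R) (x : V) : R :=
  \sum_(y \in nbrs x) weight G x y / vmeasure x * (u y - u x).

Definition grad_norm (u : V -> R) (x : V) : R :=
  Num.sqrt (\sum_(y \in nbrs x)
    weight G x y / (2 * vmeasure x) * (u y - u x) ^+ 2).

(* [powR] has 0 `^ 0 = 1, but also 0 `^ q = 0 for q < 0, where the value
   wanted here is +oo. *)
Definition epow (a q : R) : \bar R :=
  if (a == 0) && (q < 0) then +oo%E else (a `^ q)%:E.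

Definition satisfies_ineq (p q : R) (u : V -> R) : Prop :=
  forall x, ((laplacian u x)%:E
             + (u x `^ p)%:E * epow (grad_norm u x) q <= 0)%E.

Definition nontrivial_positive_solution (p q : R) (u : V -> R) : Prop :=
  [/\ forall x, 0 < u x,
      exists x y, u x != u y
    & satisfies_ineq p q u].

End WeightedGraph.

(* Main.v *)
Require Import Defs.
From mathcomp Require Import all_boot all_order all_algebra.
From mathcomp Require Import all_classical all_reals all_analysis.
From mathcomp Require Import ring lra.

Set Implicit Arguments.
Unset Strict Implicit.
Unset Printing Implicit Defensive.

Import Order.TTheory GRing.Theory Num.Theory.

Local Open Scope classical_set_scope.
Local Open Scope ring_scope.

(** A solution [u] is superharmonic: [- laplacian u x] is the amount by which
    [u x] exceeds the average of [u] over the neighbours of [x].  Hence some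
    neighbour [y] of [x] satisfies [u y <= u x + laplacian u x], and following
    such neighbours yields a descending sequence of positive values.  The
    theorem says that the inequality makes each step of this descent so large
    that the values would become negative.

    The size of a step is bounded below by eliminating the gradient, that is,
    by proving [c * u x `^ s <= - laplacian u x] for some [c > 0] and [s < 1],
    at each vertex where the gradient does not vanish.
    - If [0 <= q < 1], Jensen's inequality bounds the gradient from below by
      [- laplacian u x / sqrt 2] ([laplacian_le_grad_norm]); solving the
      inequality for the Laplacian gives [s = p / (1 - q)]
      ([drop_of_sublinear_gradient]).
    - If [q < 0], a bound from above is needed.  As [u] is positive, its
      average at [x] is at least [u y / p0] for each neighbour [y], so
      [u y <= p0 * u x], and the gradient is at most [p0 * u x]
      ([grad_norm_le]); this gives [s = p + q]
      ([drop_of_negative_gradient]).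
    A descent with steps [c * t `^ s] from the value [t], [s < 1], must leave
    the positive reals ([no_power_descent]).  It never gets stuck at a critical
    point: the vertex it moves to has a neighbour with a different value of
    [u], namely the vertex it came from, so its gradient is positive too.

    For [(p, q) = (1, 0)] one has [s = 1], and a single step already reaches a
    value [u y <= u x - u x = 0]. *)

(** * Real powers and descents *)

Lemma le0_ler_powR (R : realType) (r x y : R) :
  r <= 0 -> 0 < x -> x <= y -> y `^ r <= x `^ r.
Proof.
move=> r0 x0 xy; have y0 : 0 < y by apply: lt_le_trans xy.
rewrite -[r]opprK !(powRN _ (- r)) lef_pV2 ?posrE ?powR_gt0//.
by apply: ge0_ler_powR; rewrite ?nnegrE ?oppr_ge0 // ltW.
Qed.

(** A step of size [c * t `^ s] from [t] to a positive value forces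
    [c < t `^ (1 - s)], which bounds [t] away from 0 because [s < 1].  Since [t]
    also stays below the initial value, the steps are bounded below by a
    positive constant [d], and boundedly many of them are possible. *)
Lemma no_power_descent (R : realType) (T : Type) (P : T -> Prop)
    (u : T -> R) (c s : R) :
  0 < c -> s < 1 -> (forall x, P x -> 0 < u x) ->
  (forall x, P x -> exists2 y, P y & u y <= u x - c * u x `^ s) ->
  forall x, ~ P x.
Proof.
move=> c0 s1 u0 step x0 Px0.
have r0 : 0 < 1 - s by rewrite subr_gt0.
pose m := c `^ (1 - s)^-1; pose k := u x0 `^ (s - 1).
have m0 : 0 < m by apply: powR_gt0.
have k0 : 0 < k by apply/powR_gt0/u0.
pose d := c * (m * k).
have d0 : 0 < d by rewrite !mulr_gt0.
have size_step x : P x -> u x <= u x0 -> d <= c * u x `^ s.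
  move=> Px ux; have ux0 := u0 _ Px.
  have us a b : u x `^ (a + b) = u x `^ a * u x `^ b.
    by rewrite powRD// (gt_eqF ux0) implybT.
  have [y Py uy] := step _ Px.
  (* The step ends at a positive value, so it is smaller than [u x]. *)
  have c_lt : c * u x `^ s < u x by have := u0 _ Py; lra.
  have c_le : c <= u x `^ (1 - s).
    have us0 : 0 < u x `^ s by apply: powR_gt0.
    by rewrite -(ler_pM2r us0) -us subrK powRr1 ltW.
  have m_le : m <= u x.
    rewrite -[leRHS]powRr1 ?(ltW ux0)// -[X in _ `^ X](mulfV (lt0r_neq0 r0)).
    rewrite powRrM; apply: ge0_ler_powR; rewrite ?nnegrE ?powR_ge0//.
    - by rewrite invr_ge0 ltW.
    - exact: ltW.
  (* [u x `^ s = u x * u x `^ (s - 1)], where the first factor is at least [m]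
     and the second at least [k], because [s - 1 < 0] and [u x <= u x0]. *)
  rewrite ler_pM2l// -[s in leRHS](subrKC 1) us powRr1 ?(ltW ux0)//.
  apply: ler_pM => //; try exact: ltW.
  by apply: le0_ler_powR => //; rewrite subr_le0 ltW.
have iter n : exists2 x, P x & u x <= u x0 - d *+ n.
  elim: n => [|n [x Px ux]]; first by exists x0; rewrite // mulr0n subr0.
  have [y Py uy] := step _ Px; exists y => //.
  have dn : 0 <= d *+ n by rewrite mulrn_wge0 // ltW.
  have := size_step _ Px; rewrite mulrSr => /(_ ltac:(lra)); lra.
have q0 : 0 <= u x0 / d by rewrite divr_ge0 // ltW // u0.
have [x Px ux] := iter (Num.bound (u x0 / d)).
have := archi_boundP q0; rewrite ltr_pdivrMr// mulrC mulr_natr.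
by have := u0 _ Px; lra.
Qed.

(** * Averages over neighbours *)

Section Averages.
Context {R : realType} {V : choiceType} (G : weighted_graph R V).
Hypothesis Gfin : locally_finite_graph G.

Definition nbr_mean (x : V) (f : V -> R) : R :=
  \sum_(y \in nbrs G x) weight G x y / vmeasure G x * f y.

Lemma vmeasure_ge0 x : 0 <= vmeasure G x.
Proof. by apply: fsumr_ge0 => y xy; apply/ltW/weight_gt0. Qed.

Lemma vmeasure_gt0 x y : adj G x y -> 0 < vmeasure G x.
Proof.
move=> xy; rewrite /vmeasure (fsbigD1 y)//; apply: ltr_wpDr.
  by apply: fsumr_ge0 => z [xz _]; apply/ltW/weight_gt0.
exact: weight_gt0.
Qed.

Lemma transition_ge0 x y : adj G x y -> 0 <= weight G x y / vmeasure G x.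
Proof.
by move=> xy; rewrite divr_ge0 ?vmeasure_ge0//; apply/ltW/weight_gt0.
Qed.

Lemma transition_gt0 x y : adj G x y -> 0 < weight G x y / vmeasure G x.
Proof.
by move=> xy; rewrite divr_gt0 ?(vmeasure_gt0 xy)//; apply/weight_gt0.
Qed.

Lemma eq_nbr_mean x f g :
  (forall y, adj G x y -> f y = g y) -> nbr_mean x f = nbr_mean x g.
Proof. by move=> fg; apply: eq_fsbigr => y; rewrite inE => /fg ->. Qed.

Lemma nbr_meanD x f g :
  nbr_mean x (fun y => f y + g y) = nbr_mean x f + nbr_mean x g.
Proof.
rewrite /nbr_mean -fsbig_split//=.
by apply: eq_fsbigr => y _; rewrite mulrDr.
Qed.

Lemma nbr_meanZ x a f : nbr_mean x (fun y => a * f y) = a * nbr_mean x f.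
Proof.
by rewrite /nbr_mean mulr_fsumr; apply: eq_fsbigr => y _; rewrite mulrCA.
Qed.

Lemma nbr_mean_cst x y a : adj G x y -> nbr_mean x (fun=> a) = a.
Proof.
move=> xy; rewrite /nbr_mean -!mulr_fsuml -/(vmeasure G x).
by rewrite divff ?mul1r// (gt_eqF (vmeasure_gt0 xy)).
Qed.

Lemma nbr_mean_ge0 x f : (forall y, adj G x y -> 0 <= f y) -> 0 <= nbr_mean x f.
Proof.
by move=> f0; apply: fsumr_ge0 => y xy; rewrite mulr_ge0 ?transition_ge0 ?f0.
Qed.

Lemma ler_nbr_mean x f g :
  (forall y, adj G x y -> f y <= g y) -> nbr_mean x f <= nbr_mean x g.
Proof.
move=> fg; rewrite -subr_ge0 -mulN1r -nbr_meanZ -nbr_meanD.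
by apply: nbr_mean_ge0 => y xy; rewrite mulN1r subr_ge0 fg.
Qed.

Lemma nbr_mean_ge_term x y f : adj G x y ->
  (forall z, adj G x z -> 0 <= f z) ->
  weight G x y / vmeasure G x * f y <= nbr_mean x f.
Proof.
move=> xy f0; rewrite /nbr_mean (fsbigD1 y)//= lerDl.
by apply: fsumr_ge0 => z [xz _]; rewrite mulr_ge0 ?transition_ge0 ?f0.
Qed.

(** Jensen's inequality for the square, from the nonnegativity of the
    variance. *)
Lemma sqr_nbr_mean_le x y f : adj G x y ->
  nbr_mean x f ^+ 2 <= nbr_mean x (fun z => f z ^+ 2).
Proof.
move=> xy; set m := nbr_mean x f.
have : 0 <= nbr_mean x (fun z => (f z - m) ^+ 2).
  by apply: nbr_mean_ge0 => z _; apply: sqr_ge0.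
rewrite (@eq_nbr_mean x _ (fun z => f z ^+ 2 + ((- 2 * m) * f z + m ^+ 2))).
  rewrite nbr_meanD (nbr_meanD x (fun z => _ * f z)) nbr_meanZ.
  by rewrite (nbr_mean_cst _ xy) -/m; lra.
by move=> z _; ring.
Qed.

(** * Laplacian and gradient *)

Variable u : V -> R.

Lemma laplacian_mean x y : adj G x y -> laplacian G u x = nbr_mean x u - u x.
Proof.
move=> xy; rewrite -[laplacian _ _ _]/(nbr_mean _ _) nbr_meanD.
by rewrite (nbr_mean_cst _ xy).
Qed.

Lemma grad_norm_ge0 x : 0 <= grad_norm G u x.
Proof. exact: sqrtr_ge0. Qed.

Lemma grad_norm_sqr x :
  grad_norm G u x ^+ 2 = nbr_mean x (fun y => (u y - u x) ^+ 2) / 2.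
Proof.
have -> : nbr_mean x (fun y => (u y - u x) ^+ 2) / 2 =
    \sum_(y \in nbrs G x) weight G x y / (2 * vmeasure G x) * (u y - u x) ^+ 2.
  rewrite mulrC /nbr_mean mulr_fsumr; apply: eq_fsbigr => y _.
  by rewrite invfM; ring.
rewrite sqr_sqrtr//; apply: fsumr_ge0 => y xy.
rewrite mulr_ge0 ?sqr_ge0// divr_ge0 ?mulr_ge0 ?vmeasure_ge0//.
exact/ltW/weight_gt0.
Qed.

Lemma grad_norm_gt0P x :
  0 < grad_norm G u x <-> exists2 y, adj G x y & u y != u x.
Proof.
have sq_ge0 y : adj G x y -> 0 <= (u y - u x) ^+ 2 by move=> _; apply: sqr_ge0.
split=> [|[y xy uy]].
  apply: contraPP => /forall2NP cst; apply/negP; rewrite -leNgt.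
  rewrite -(@ler_pXn2r _ 2) ?nnegrE ?grad_norm_ge0// grad_norm_sqr expr0n/=.
  rewrite (@eq_nbr_mean x _ (fun y => 0 * 0)) ?nbr_meanZ ?mul0r// => y xy.
  have [//|/negP] := cst y; rewrite negbK => /eqP ->.
  by rewrite subrr expr0n.
rewrite lt0r grad_norm_ge0 andbT -sqrf_eq0 gt_eqF// grad_norm_sqr.
rewrite divr_gt0//; apply: lt_le_trans (nbr_mean_ge_term xy sq_ge0).
rewrite mulr_gt0 ?transition_gt0// lt0r sqr_ge0 andbT.
by rewrite expf_eq0/= subr_eq0.
Qed.

(** Jensen's inequality; the [sqrt 2] comes from the factor [1 / 2] in the
    definition of the gradient. *)
Lemma laplacian_le_grad_norm x :
  - laplacian G u x / Num.sqrt 2 <= grad_norm G u x.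
Proof.
have [[y xy]|no_nbr] := pselect (exists y, adj G x y); last first.
  rewrite /laplacian fsbig1 ?oppr0 ?mul0r ?grad_norm_ge0// => y xy.
  by case: no_nbr; exists y.
apply: (le_trans (ler_norm _)).
rewrite -(@ler_pXn2r _ 2) ?nnegrE ?grad_norm_ge0//.
rewrite real_normK ?num_real// exprMn sqrrN exprVn sqr_sqrtr// grad_norm_sqr.
by rewrite ler_pM2r ?invr_gt0//; apply: sqr_nbr_mean_le xy.
Qed.

(** If all neighbours had values above [u x - d], then so would their average,
    being a convex combination of finitely many of them. *)
Lemma exists_drop x d : 0 < d -> d <= - laplacian G u x ->
  exists2 y, adj G x y & u y <= u x - d.
Proof.
move=> d0 dx; apply: contrapT => /forall2NP no_drop.
have lt_drop y : adj G x y -> u x - d < u y.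
  by move=> xy; case: (no_drop y) => // /negP; rewrite -ltNge.
(* Some neighbour exists, because the Laplacian at [x] is not zero. *)
have [y xy _] : exists2 y, adj G x y &
    weight G x y / vmeasure G x * (u y - u x) < 0.
  by apply: fsumr_lt0; rewrite -/(laplacian G u x); lra.
have f0 z : adj G x z -> 0 <= u z + (d - u x).
  by move/lt_drop => uz; lra.
have := nbr_mean_ge_term xy f0.
rewrite nbr_meanD (nbr_mean_cst _ xy).
have : 0 < weight G x y / vmeasure G x * (u y + (d - u x)).
  by rewrite mulr_gt0 ?transition_gt0//; have := lt_drop _ xy; lra.
by move: dx; rewrite (laplacian_mean xy); lra.
Qed.

(** Positivity of [u] turns superharmonicity into an upper bound at the
    neighbours: each of them contributes at least [p0^-1] times its value
    to the average, which is at most [u x]. *)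
Lemma nbr_le_superharmonic (p0 : R) x y : 0 < p0 -> (forall z, 0 < u z) ->
  p0^-1 <= weight G x y / vmeasure G x -> laplacian G u x <= 0 ->
  adj G x y -> u y <= p0 * u x.
Proof.
move=> p0_gt0 u0 wxy Lx xy; rewrite -ler_pdivrMl//.
have := nbr_mean_ge_term xy (fun z _ => ltW (u0 z)).
have : p0^-1 * u y <= weight G x y / vmeasure G x * u y by rewrite ler_pM2r.
by move: Lx; rewrite (laplacian_mean xy); lra.
Qed.

(** Since [0 < u y <= p0 * u x] and [u x <= p0 * u x], each difference
    [u y - u x] is at most [p0 * u x] in absolute value. *)
Lemma grad_norm_le (p0 : R) x : 1 <= p0 -> (forall z, 0 < u z) ->
  (forall y, adj G x y -> p0^-1 <= weight G x y / vmeasure G x) ->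
  laplacian G u x <= 0 -> grad_norm G u x <= p0 * u x.
Proof.
move=> p0_ge1 u0 w_ge Lx.
have pux : u x <= p0 * u x by rewrite ler_peMl// ltW.
have p0u_ge0 : 0 <= p0 * u x by apply: le_trans pux; apply: ltW.
rewrite -(@ler_pXn2r _ 2) ?nnegrE ?grad_norm_ge0// grad_norm_sqr.
have [[y xy]|no_nbr] := pselect (exists y, adj G x y); last first.
  rewrite /nbr_mean fsbig1 ?mul0r ?sqr_ge0// => y xy.
  by case: no_nbr; exists y.
have : nbr_mean x (fun y => (u y - u x) ^+ 2)
    <= nbr_mean x (fun=> (p0 * u x) ^+ 2).
  apply: ler_nbr_mean => z xz.
  rewrite -[leLHS]real_normK ?num_real// ler_pXn2r ?nnegrE//.
  have := @nbr_le_superharmonic p0 x z ltac:(lra) u0 (w_ge _ xz) Lx xz.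
  rewrite ler_norml.
  by have := u0 z; have := u0 x; lra.
rewrite (nbr_mean_cst _ xy); have := sqr_ge0 (p0 * u x); lra.
Qed.

(** * Elimination of the gradient *)

Lemma epow_real_ineq p q x : 0 < grad_norm G u x ->
  ((laplacian G u x)%:E + (u x `^ p)%:E * epow (grad_norm G u x) q <= 0)%E ->
  u x `^ p * grad_norm G u x `^ q <= - laplacian G u x.
Proof.
move=> g0; rewrite /epow (gt_eqF g0)/= -EFinM -EFinD lee_fin; lra.
Qed.

(** Let [D = - laplacian u x].  As [0 <= q], the lower bound [D / sqrt 2] on the
    gradient gives [u x `^ p * (D / sqrt 2) `^ q <= D].  As [q < 1] and [0 < D],
    this can be solved for [D]. *)
Lemma drop_of_sublinear_gradient (p q : R) x : 0 <= q -> q < 1 -> 0 < u x ->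
  0 < grad_norm G u x ->
  u x `^ p * grad_norm G u x `^ q <= - laplacian G u x ->
  (Num.sqrt 2)^-1 `^ (q / (1 - q)) * u x `^ (p / (1 - q)) <= - laplacian G u x.
Proof.
move=> q0 q1 ux0 g0; set D := - laplacian G u x; set K := (Num.sqrt 2)^-1.
move=> ineq.
have r0 : 0 < 1 - q by lra.
have D0 : 0 < D by apply: lt_le_trans ineq; rewrite mulr_gt0 ?powR_gt0.
have K0 : 0 < K by rewrite invr_gt0 sqrtr_gt0.
have DK : (D * K) `^ q <= grad_norm G u x `^ q.
  apply: ge0_ler_powR; rewrite ?nnegrE ?(ltW g0)//.
    by rewrite mulr_ge0 // ltW.
  exact: laplacian_le_grad_norm.
have pow_D : K `^ q * u x `^ p <= D `^ (1 - q).
  have Dq0 : 0 < D `^ q by apply: powR_gt0.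
  rewrite -(ler_pM2r Dq0) -powRD ?(gt_eqF D0) ?implybT// subrK
    powRr1 ?(ltW D0)//.
  apply: le_trans ineq; rewrite -(ler_pM2l (powR_gt0 p ux0)) in DK.
  apply: le_trans DK; rewrite powRM ?(ltW D0) ?(ltW K0)//.
  by rewrite mulrA [leRHS]mulrC mulrA.
rewrite !powRrM -powRM ?powR_ge0// -[leRHS]powRr1 ?(ltW D0)//.
rewrite -[X in _ <= _ `^ X](mulfV (lt0r_neq0 r0)) powRrM.
apply: ge0_ler_powR; rewrite ?nnegrE ?mulr_ge0 ?powR_ge0//.
by rewrite invr_ge0 ltW.
Qed.

Lemma drop_of_negative_gradient (p q p0 : R) x : q <= 0 -> 0 < p0 -> 0 < u x ->
  0 < grad_norm G u x -> grad_norm G u x <= p0 * u x ->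
  u x `^ p * grad_norm G u x `^ q <= - laplacian G u x ->
  p0 `^ q * u x `^ (p + q) <= - laplacian G u x.
Proof.
move=> q0 p0_gt0 ux0 g0 g_le; apply: le_trans.
rewrite powRD ?(gt_eqF ux0) ?implybT// mulrCA -powRM ?(ltW p0_gt0) ?(ltW ux0)//.
by rewrite ler_pM2l ?powR_gt0//; apply: le0_ler_powR.
Qed.

(** * Descent along the graph *)

(** The induction hypothesis of the descent is a positive gradient, which a
    strict drop from [x] to [y] transports to [y] because [x] is a neighbour
    of [y]. *)
Lemma no_power_drop (c s : R) : 0 < c -> s < 1 -> (forall x, 0 < u x) ->
  (forall x, 0 < grad_norm G u x -> c * u x `^ s <= - laplacian G u x) ->
  forall x, ~ 0 < grad_norm G u x.
Proof.
move=> c0 s1 u0 drop.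
apply: (no_power_descent c0 s1 (fun x _ => u0 x)) => x /drop dropx.
have d0 : 0 < c * u x `^ s by rewrite mulr_gt0 ?powR_gt0.
have [y xy uy] := exists_drop d0 dropx.
exists y => //; apply/grad_norm_gt0P; exists x; first by rewrite adj_sym.
by rewrite gt_eqF//; lra.
Qed.

Lemma exists_grad_norm_gt0 : connected_graph G -> (exists x y, u x != u y) ->
  exists x, 0 < grad_norm G u x.
Proof.
move=> Gconn [x [y /eqP nxy]]; apply: contrapT => crit; apply: nxy.
have [s] := Gconn x y; elim: s x => [|z s IH] x /=; first by move=> _ ->.
move=> /andP[xz zs] sy; have uz : u z = u x.
  apply/eqP; apply: contrapT => uz; apply: crit.
  by exists x; apply/grad_norm_gt0P; exists z => //; apply/negP.
by rewrite -uz; apply: IH.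
Qed.

End Averages.

Theorem theorem1p3 (R : realType) (V : choiceType) (G : weighted_graph R V)
    (p q : R)
    (Vinf : infinite_set [set: V])
    (Gconn : connected_graph G)
    (Gfin : locally_finite_graph G)
    (Hpq :
      ((exists p0 : R, 1 <= p0 /\
          forall x y, adj G x y -> p0^-1 <= weight G x y / vmeasure G x)
        /\ p < 1 - q /\ q < 0)
      \/
      ((p < 1 - q /\ 0 <= q /\ q < 1) \/ (p = 1 /\ q = 0))) :
  ~ exists u : V -> R, nontrivial_positive_solution G p q u.
Proof.
move=> [u [u0 ncst sol]].
have [x gx] := exists_grad_norm_gt0 Gfin Gconn ncst.
have ineq z (gz : 0 < grad_norm G u z) := epow_real_ineq gz (sol z).
case: Hpq => [[[p0 [p0_ge1 w_ge]] [pq q0]]|[[pq [q0 q1]]|[p1 q0]]].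
- have p0_gt0 : 0 < p0 by lra.
  apply: (@no_power_drop _ _ _ Gfin u (p0 `^ q) (p + q) _ _ u0 _ x gx).
  + exact: powR_gt0.
  + lra.
  move=> z gz; apply: drop_of_negative_gradient (ineq z gz) => //.
    exact: ltW.
  apply: grad_norm_le => //; first by move=> y; apply: w_ge.
  rewrite -oppr_ge0; apply: le_trans (ineq z gz).
  by rewrite mulr_ge0 ?powR_ge0.
- apply: (@no_power_drop _ _ _ Gfin u ((Num.sqrt 2)^-1 `^ (q / (1 - q)))
            (p / (1 - q)) _ _ u0 _ x gx).
  + by rewrite powR_gt0// invr_gt0 sqrtr_gt0.
  + by rewrite ltr_pdivrMr; lra.
  by move=> z gz; apply: drop_of_sublinear_gradient (ineq z gz).
- have := ineq x gx; rewrite p1 q0 powRr0 mulr1 powRr1 ?(ltW (u0 x))// => dropx.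
  have [y _] := exists_drop Gfin (u0 x) dropx.
  by have := u0 y; lra.
Qed.
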